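(* Let $\mathcal C$ be a $\mathcal Z$-prenormal category in which every $\mathcal Z$-normal epimorphism is also a regular epimorphism. Let $\mathcal F$ be a $\mathcal Z$-normal-epi-reflective (full, replete) subcategory of $\mathcal C$, with reflector $F\colon\mathcal C\to\mathcal F$ and unit $\varphi$, with components $\varphi_X\colon X\to FX$. Then the following are equivalent. (i) $\mathcal F$ is a $\mathcal Z$-torsion-free subcategory of $\mathcal C$. (ii) For every object $X$ of $\mathcal C$, if $(K,k)$ is the $\mathcal Z$-kernel of $\varphi_X$, then the naturality square $$\begin{array}{ccc} K & \xrightarrow{k} & X\\ {\scriptstyle \varphi_K}\downarrow & & \downarrow{\scriptstyle \varphi_X}\\ FK & \xrightarrow{Fk} & FX\end{array}$$ is a pullback.
   Context: Let $\mathcal C$ be a category and $\mathcal Z$ a full replete subcategory (the trivial objects). A morphism of $\mathcal C$ is $\mathcal Z$-trivial if it factors through an object of $\mathcal Z$. A $\mathcal Z$-kernel of $f\colon A\to B$ is a pair $(K,k\colon K\to A)$ such that $f\circ k$ is $\mathcal Z$-trivial and every $x\colon X\to A$ with $f\circ x$ $\mathcal Z$-trivial factors uniquely as $x=k\circ x'$. A $\mathcal Z$-cokernel is defined dually. A $\mathcal Z$-normal monomorphism (resp. $\mathcal Z$-normal epimorphism) is a morphism that is a $\mathcal Z$-kernel (resp. $\mathcal Z$-cokernel) of some morphism. A sequence $A\xrightarrow{f}B\xrightarrow{g}C$ is $\mathcal Z$-exact if $(A,f)$ is the $\mathcal Z$-kernel of $g$ and $(C,g)$ is the $\mathcal Z$-cokernel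 of $f$. $\mathcal C$ is semi-$\mathcal Z$-prenormal if $\mathcal Z$ is mono-coreflective in $\mathcal C$ (the inclusion has a right adjoint and the counit components are monomorphisms) and: (1) $\mathcal C$ has pullbacks along $\mathcal Z$-normal monomorphisms; (2) $\mathcal C$ has $\mathcal Z$-cokernels of $\mathcal Z$-kernels; (3) the pullback of a $\mathcal Z$-normal epimorphism along a $\mathcal Z$-normal monomorphism is a $\mathcal Z$-normal epimorphism. $\mathcal C$ is $\mathcal Z$-prenormal if in addition it is finitely complete and $\mathcal Z$-normal epimorphisms are stable under pullback along arbitrary morphisms. A $\mathcal Z$-torsion theory on $\mathcal C$ is a pair $(\mathcal T,\mathcal F)$ of full replete subcategories such that every morphism $A\to B$ with $A\in\mathcal T$, $B\in\mathcal F$ is $\mathcal Z$-trivial, and for every object $X$ there is a $\mathcal Z$-exact sequence $A\to X\to B$ with $A\in\mathcal T$ and $B\in\mathcal F$. A subcategory $\mathcal F$ is $\mathcal Z$-torsion-free if there is a $\mathcal T$ such that $(\mathcal T,\mathcal F)$ is a $\mathcal Z$-torsion theory. A full replete subcategory $\mathcal F$ is $\mathcal Z$-normal-epi-reflective if the inclusion $\mathcal F\hookrightarrow\mathcal C$ has a left adjoint and the components of the unit are $\mathcal Z$-normal epimorphisms. *)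

(* Defs.v *)
From Stdlib Require Import List.

Set Implicit Arguments.
Unset Strict Implicit.
Unset Printing Implicit Defensive.

Declare Scope cat_scope.
Delimit Scope cat_scope with cat.
Open Scope cat_scope.

Record category := Category {
  obj :> Type;
  hom : obj -> obj -> Type;
  idm : forall A, hom A A;
  comp : forall A B C, hom B C -> hom A B -> hom A C;
  comp_idl : forall A B (f : hom A B), comp (idm B) f = f;
  comp_idr : forall A B (f : hom A B), comp f (idm A) = f;
  comp_assoc : forall A B C D (h : hom C D) (g : hom B C) (f : hom A B),
      comp h (comp g f) = comp (comp h g) f
}.

Arguments hom {c} A B.
Arguments idm {c} A.
Arguments comp {c A B C} g f.

Notation "g ∘ f" := (comp g f) (at level 40, left associativity) : cat_scope.

Record functor (C D : category) := Functor {
  fobj :> C -> D;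
  fmap : forall A B : C, hom A B -> hom (fobj A) (fobj B);
  fmap_id : forall A : C, fmap (idm A) = idm (fobj A);
  fmap_comp : forall (X Y Z : C) (g : hom Y Z) (f : hom X Y),
      fmap (g ∘ f) = fmap g ∘ fmap f
}.

Arguments fmap {C D} _ {A B} _.

Definition id_functor (C : category) : functor C C :=
  {| fobj := fun A => A;
     fmap := fun A B f => f;
     fmap_id := fun A => eq_refl;
     fmap_comp := fun X Y Z g f => eq_refl |}.

Definition comp_functor (C D E : category) (G : functor D E) (F : functor C D) :
  functor C E :=
  {| fobj := fun A => G (F A);
     fmap := fun A B f => fmap G (fmap F f);
     fmap_id := fun A => eq_trans (f_equal (fmap G) (fmap_id F A)) (fmap_id G (F A));
     fmap_comp := fun X Y Z g f =>
       eq_trans (f_equal (fmap G) (fmap_comp F g f))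
                (fmap_comp G (fmap F g) (fmap F f)) |}.

Record nattrans (C D : category) (F G : functor C D) := NatTrans {
  component :> forall A : C, hom (F A) (G A);
  naturality : forall (A B : C) (f : hom A B),
      component B ∘ fmap F f = fmap G f ∘ component A
}.

(* [adjunction L R] : [L] is left adjoint to [R]. *)
Record adjunction (C D : category) (L : functor C D) (R : functor D C) :=
  Adjunction {
  unit_of : nattrans (id_functor C) (comp_functor R L);
  counit_of : nattrans (comp_functor L R) (id_functor D);
  triangle_left : forall A : C, counit_of (L A) ∘ fmap L (unit_of A) = idm (L A);
  triangle_right : forall B : D, fmap R (counit_of B) ∘ unit_of (R B) = idm (R B)
}.

Section Limits.
Variable C : category.

Definition isomorphism (A B : C) (f : hom A B) : Prop :=
  exists g : hom B A, g ∘ f = idm A /\ f ∘ g = idm B.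

Definition mono (A B : C) (f : hom A B) : Prop :=
  forall (X : C) (u v : hom X A), f ∘ u = f ∘ v -> u = v.

Definition is_coequalizer (A B Q : C) (u v : hom A B) (q : hom B Q) : Prop :=
  q ∘ u = q ∘ v /\
  forall (Y : C) (y : hom B Y), y ∘ u = y ∘ v ->
    exists! y' : hom Q Y, y = y' ∘ q.

Definition regular_epi (B Q : C) (q : hom B Q) : Prop :=
  exists (A : C) (u v : hom A B), is_coequalizer u v q.

(* The square
<<
     P --p--> A
     |        |
     q        f
     v        v
     B --g--> D
>> *)
Definition is_pullback (P A B D : C) (p : hom P A) (q : hom P B)
    (f : hom A D) (g : hom B D) : Prop :=
  f ∘ p = g ∘ q /\
  forall (X : C) (a : hom X A) (b : hom X B), f ∘ a = g ∘ b ->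
    exists! x : hom X P, p ∘ x = a /\ q ∘ x = b.

Definition is_cone (J : category) (D : functor J C) (L : C)
    (c : forall j : J, hom L (D j)) : Prop :=
  forall (i j : J) (u : hom i j), fmap D u ∘ c i = c j.

Definition is_limit (J : category) (D : functor J C) (L : C)
    (c : forall j : J, hom L (D j)) : Prop :=
  is_cone c /\
  forall (X : C) (d : forall j : J, hom X (D j)), is_cone d ->
    exists! x : hom X L, forall j : J, c j ∘ x = d j.

End Limits.

Definition finite_type (T : Type) : Prop := exists l : list T, forall x, In x l.

Definition finite_category (J : category) : Prop :=
  finite_type J /\ forall i j : J, finite_type (hom i j).

Definition finitely_complete (C : category) : Prop :=
  forall (J : category) (D : functor J C), finite_category J ->
    exists (L : C) (c : forall j : J, hom L (D j)), is_limit c.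

Record subcat (C : category) := Subcat {
  mem :> C -> Prop;
  replete : forall (A B : C) (f : hom A B), isomorphism f -> mem A -> mem B
}.

Definition full_subcategory (C : category) (S : subcat C) : category :=
  {| obj := {A : C | S A};
     hom := fun A B => hom (proj1_sig A) (proj1_sig B);
     idm := fun A => idm (proj1_sig A);
     comp := fun X Y Z g f => g ∘ f;
     comp_idl := fun A B f => comp_idl f;
     comp_idr := fun A B f => comp_idr f;
     comp_assoc := fun X Y Z W h g f => comp_assoc h g f |}.

Definition inclusion (C : category) (S : subcat C) : functor (full_subcategory S) C :=
  {| fobj := fun A : full_subcategory S => proj1_sig A;
     fmap := fun (A B : full_subcategory S) (f : hom A B) => f;
     fmap_id := fun A => eq_refl;
     fmap_comp := fun X Y Z g f => eq_refl |}.

Definition mono_coreflective (C : category) (S : subcat C) : Prop :=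
  exists (R : functor C (full_subcategory S)) (adj : adjunction (inclusion S) R),
    forall X : C, mono (counit_of adj X).

Section Trivial.
Variables (C : category) (Z : subcat C).

Definition trivial_mor (A B : C) (f : hom A B) : Prop :=
  exists (W : C) (u : hom A W) (v : hom W B), Z W /\ f = v ∘ u.

Definition is_kernel (K A B : C) (f : hom A B) (k : hom K A) : Prop :=
  trivial_mor (f ∘ k) /\
  forall (X : C) (x : hom X A), trivial_mor (f ∘ x) ->
    exists! x' : hom X K, x = k ∘ x'.

Definition is_cokernel (A B Q : C) (f : hom A B) (q : hom B Q) : Prop :=
  trivial_mor (q ∘ f) /\
  forall (Y : C) (y : hom B Y), trivial_mor (y ∘ f) ->
    exists! y' : hom Q Y, y = y' ∘ q.

Definition normal_mono (K A : C) (k : hom K A) : Prop :=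
  exists (B : C) (f : hom A B), is_kernel f k.

Definition normal_epi (B Q : C) (q : hom B Q) : Prop :=
  exists (A : C) (f : hom A B), is_cokernel f q.

Definition exact_seq (A B D : C) (f : hom A B) (g : hom B D) : Prop :=
  is_kernel g f /\ is_cokernel f g.

Definition has_pullbacks_along_normal_monos : Prop :=
  forall (M A B : C) (m : hom M B) (f : hom A B), normal_mono m ->
    exists (P : C) (p : hom P A) (q : hom P M), is_pullback p q f m.

Definition has_cokernels_of_kernels : Prop :=
  forall (K A B : C) (f : hom A B) (k : hom K A), is_kernel f k ->
    exists (Q : C) (q : hom A Q), is_cokernel k q.

Definition normal_epis_stable_along_normal_monos : Prop :=
  forall (P A M B : C) (p : hom P A) (q : hom P M) (f : hom A B) (m : hom M B),
    is_pullback p q f m -> normal_epi f -> normal_mono m -> normal_epi q.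

Definition normal_epis_stable : Prop :=
  forall (P A M B : C) (p : hom P A) (q : hom P M) (f : hom A B) (g : hom M B),
    is_pullback p q f g -> normal_epi f -> normal_epi q.

Record semi_prenormal : Prop := SemiPrenormal {
  sp_mono_coreflective : mono_coreflective Z;
  sp_pullbacks : has_pullbacks_along_normal_monos;
  sp_cokernels : has_cokernels_of_kernels;
  sp_stable : normal_epis_stable_along_normal_monos
}.

Record prenormal : Prop := Prenormal {
  pn_semi_prenormal : semi_prenormal;
  pn_finitely_complete : finitely_complete C;
  pn_stable : normal_epis_stable
}.

Record torsion_theory (T F : subcat C) : Prop := TorsionTheory {
  tt_trivial : forall (A B : C) (f : hom A B), T A -> F B -> trivial_mor f;
  tt_exact : forall X : C, exists (A B : C) (f : hom A X) (g : hom X B),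
      T A /\ F B /\ exact_seq f g
}.

Definition torsion_free (F : subcat C) : Prop :=
  exists T : subcat C, torsion_theory T F.

End Trivial.

(* Main.v *)
Require Import Defs.

Set Implicit Arguments.
Unset Strict Implicit.

(** Let [k : K -> X] be the [Z]-kernel of the unit component [φ_X : X -> FX], and
    let [ε : W -> FX] be the coreflection of [FX] into [Z].  As [ε] is monic and
    trivial morphisms into [FX] are the ones factoring through [ε], the object [K] is
    the pullback of [φ_X] along [ε]; let [e : K -> W] be the other projection
    ([normal_epi_kernel]).  It is a normal epimorphism, because [ε] is a normal
    monomorphism.  Moreover [Z] is contained in [F] ([trivial_objects_reflected]), so
    [e] factors as [t ∘ φ_K], and [Fk = ε ∘ t].

    Everything is linked by the condition that [φ_K] be trivial.

    - It characterizes torsion-freeness ([torsion_free_iff_kernel_unit_trivial]).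
      The torsion part of [X] can only be the kernel of [φ_X], and torsion objects
      have a trivial unit; conversely the objects with trivial unit form the torsion
      class, since [φ_X], being a normal epimorphism, is the cokernel of its kernel.

    - It implies that the naturality square is a pullback
      ([kernel_unit_trivial_pullback]): the trivial morphism [φ_K] factors
      through the cokernel [e], so [t] is invertible and the naturality square is
      isomorphic to the pullback square defining [K].

    - It follows from that pullback ([pullback_kernel_unit_trivial]): as [k] is
      monic, the pullback property says that [φ_K] identifies whatever
      [φ_X ∘ k = ε ∘ e] identifies.  The regular epimorphism [e] is a coequalizer of
      some pair, so [φ_K] factors through [e], and hence through [W] in [Z]. *)

(** * Trivial morphisms, kernels and cokernels *)

Lemma trivial_mor_precomp (C : category) (Z : subcat C) (A B D : C)
  (f : hom B D) (x : hom A B) : trivial_mor Z f -> trivial_mor Z (f ∘ x).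
Proof.
intros (W & u & v & HW & ->); exists W, (u ∘ x), v.
split; [assumption | symmetry; apply comp_assoc].
Qed.

Lemma trivial_mor_postcomp (C : category) (Z : subcat C) (A B D : C)
  (y : hom B D) (f : hom A B) : trivial_mor Z f -> trivial_mor Z (y ∘ f).
Proof.
intros (W & u & v & HW & ->); exists W, u, (y ∘ v).
split; [assumption | apply comp_assoc].
Qed.

Lemma trivial_mor_split_epi (C : category) (Z : subcat C) (A B D : C)
  (y : hom B D) (r : hom A B) (i : hom B A) :
  r ∘ i = idm B -> trivial_mor Z (y ∘ r) -> trivial_mor Z y.
Proof.
intros Hri Hy; rewrite <- (comp_idr y), <- Hri, comp_assoc.
now apply trivial_mor_precomp.
Qed.

Lemma trivial_mor_target (C : category) (Z : subcat C) (A W : C) (f : hom A W) :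
  Z W -> trivial_mor Z f.
Proof. intros HW; exists W, f, (idm W); split; [assumption | now rewrite comp_idl]. Qed.

Lemma kernel_mono (C : category) (Z : subcat C) (K A B : C)
  (f : hom A B) (k : hom K A) : is_kernel Z f k -> mono k.
Proof.
intros [Hfk Huniv] X u v Huv.
destruct (Huniv X (k ∘ u)) as (w & _ & Hw).
- rewrite comp_assoc; now apply trivial_mor_precomp.
- transitivity w; [symmetry |]; now apply Hw.
Qed.

Lemma mono_mutual_factor (C : category) (A K X : C) (f : hom A X) (k : hom K X)
  (f' : hom A K) (k' : hom K A) :
  mono k -> f = k ∘ f' -> k = f ∘ k' -> f' ∘ k' = idm K.
Proof.
intros Hmono Hf Hk; apply Hmono.
now rewrite comp_assoc, <- Hf, <- Hk, comp_idr.
Qed.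

Lemma normal_epi_cancel (C : category) (Z : subcat C) (B Q : C) (q : hom B Q) :
  normal_epi Z q -> forall (Y : C) (u v : hom Q Y), u ∘ q = v ∘ q -> u = v.
Proof.
intros (A & f & Hqf & Huniv) Y u v Huv.
destruct (Huniv Y (u ∘ q)) as (w & _ & Hw).
- rewrite <- comp_assoc; now apply trivial_mor_postcomp.
- transitivity w; [symmetry |]; now apply Hw.
Qed.

(** If [q] is the cokernel of [f], then [f] factors through [k], so a morphism
    that trivializes [k] also trivializes [f]. *)
Lemma normal_epi_cokernel_of_kernel (C : category) (Z : subcat C) (K B Q : C)
  (q : hom B Q) (k : hom K B) :
  normal_epi Z q -> is_kernel Z q k -> is_cokernel Z k q.
Proof.
intros (A & f & Hqf & Hcok) [Hqk Hker]; split; [assumption |].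
intros Y y Hy; apply Hcok.
destruct (Hker A f Hqf) as (f' & -> & _).
rewrite comp_assoc; now apply trivial_mor_precomp.
Qed.

Lemma normal_epi_factor_trivial (C : category) (Z : subcat C) (B Q Y : C)
  (q : hom B Q) (y : hom B Y) :
  normal_epi Z q -> trivial_mor Z y -> exists y' : hom Q Y, y = y' ∘ q.
Proof.
intros (A & f & _ & Hcok) Hy.
destruct (Hcok Y y) as (y' & Hy' & _); [now apply trivial_mor_precomp |].
now exists y'.
Qed.

Lemma pullback_replace_leg (C : category) (P A B B' D : C) (p : hom P A)
  (q : hom P B) (q' : hom P B') (f : hom A D) (g : hom B D) (t : hom B' B) :
  isomorphism t -> t ∘ q' = q -> is_pullback p q f g ->
  is_pullback p q' f (g ∘ t).
Proof.
intros (s & Hst & Hts) Hq [Hsq Hpb]; split.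
- now rewrite <- comp_assoc, Hq.
- intros X a b Hab.
  destruct (Hpb X a (t ∘ b)) as (x & [Ha Hb] & Hx); [now rewrite comp_assoc |].
  exists x; split.
  + split; [assumption |].
    rewrite <- (comp_idl (q' ∘ x)), <- Hst, <- comp_assoc, (comp_assoc t), Hq, Hb.
    now rewrite comp_assoc, Hst, comp_idl.
  + intros x' [Ha' Hb']; apply Hx; split; [assumption |].
    now rewrite <- Hq, <- comp_assoc, Hb'.
Qed.

(** * Kernels as pullbacks of the coreflection *)

(** The form in which mono-coreflectivity enters: the counit component at [B] is a
    universal trivial morphism into [B]. *)
Definition trivial_part (C : category) (Z : subcat C) (W B : C) (eps : hom W B) :
  Prop :=
  Z W /\ mono eps /\
  forall (A : C) (f : hom A B), trivial_mor Z f -> exists g : hom A W, f = eps ∘ g.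

Lemma trivial_part_exists (C : category) (Z : subcat C) (B : C) :
  mono_coreflective Z -> exists (W : C) (eps : hom W B), trivial_part Z eps.
Proof.
intros (R & adj & Hmono).
exists (proj1_sig (R B)), (counit_of adj B).
split; [exact (proj2_sig (R B)) | split; [apply Hmono |]].
intros A f (W & u & v & HW & ->).
(* The transpose of [v] under the adjunction is [Rv] after the unit at [W]. *)
pose (W' := exist _ W HW : full_subcategory Z).
pose proof (naturality (counit_of adj) v) as Hnat.
pose proof (triangle_left adj W') as Htri.
pose (eta := unit_of adj W' : hom W (proj1_sig (R W))).
pose (Rv := fmap R v : hom (proj1_sig (R W)) (proj1_sig (R B))).
exists (Rv ∘ eta ∘ u).
rewrite !comp_assoc; f_equal.
transitivity (v ∘ ((counit_of adj W : hom (proj1_sig (R W)) W) ∘ eta)).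
- transitivity (v ∘ idm W); [now rewrite comp_idr | f_equal; now symmetry].
- rewrite comp_assoc; f_equal; now symmetry.
Qed.

Lemma trivial_part_trivial (C : category) (Z : subcat C) (W B : C) (eps : hom W B)
  (A : C) (x : hom A W) : trivial_part Z eps -> trivial_mor Z (eps ∘ x).
Proof.
intros (HW & _); apply trivial_mor_postcomp; now apply trivial_mor_target.
Qed.

(** A trivial part of [B] is the kernel of the identity of [B]. *)
Lemma trivial_part_normal_mono (C : category) (Z : subcat C) (W B : C)
  (eps : hom W B) : trivial_part Z eps -> normal_mono Z eps.
Proof.
intros Heps; pose proof Heps as (HW & Hmono & Hfac).
exists B, (idm B); split.
- rewrite comp_idl, <- (comp_idr eps); now apply trivial_part_trivial.
- intros X x; rewrite comp_idl; intros Hx.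
  destruct (Hfac X x Hx) as (g & Hg); exists g; split; [assumption |].
  intros g' Hg'; apply Hmono; congruence.
Qed.

Lemma pullback_trivial_part_kernel (C : category) (Z : subcat C) (K A B W : C)
  (f : hom A B) (k : hom K A) (e : hom K W) (eps : hom W B) :
  trivial_part Z eps -> is_pullback k e f eps -> is_kernel Z f k.
Proof.
intros Heps [Hsq Hpb]; pose proof Heps as (HW & Hmono & Hfac); split.
- rewrite Hsq; now apply trivial_part_trivial.
- intros X x Hx; destruct (Hfac X _ Hx) as (g & Hg).
  destruct (Hpb X x g Hg) as (x' & [Hkx' _] & Huniq).
  exists x'; split; [now symmetry |].
  intros x'' Hx''; apply Huniq; split; [now symmetry |].
  apply Hmono; now rewrite comp_assoc, <- Hsq, <- comp_assoc, <- Hx''.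
Qed.

Lemma kernel_pullback_trivial_part (C : category) (Z : subcat C) (K A B W : C)
  (f : hom A B) (k : hom K A) (eps : hom W B) :
  trivial_part Z eps -> is_kernel Z f k ->
  exists e : hom K W, is_pullback k e f eps.
Proof.
intros Heps [Hfk Hker]; pose proof Heps as (HW & Hmono & Hfac).
destruct (Hfac K _ Hfk) as (e & He); exists e; split; [assumption |].
intros X a b Hab.
destruct (Hker X a) as (x & Hx & Huniq).
- rewrite Hab; now apply trivial_part_trivial.
- exists x; split.
  + split; [now symmetry |].
    apply Hmono; now rewrite comp_assoc, <- He, <- comp_assoc, <- Hx.
  + intros x' [Hx' _]; apply Huniq; now symmetry.
Qed.

Lemma kernel_exists (C : category) (Z : subcat C) (A B : C) (f : hom A B) :
  semi_prenormal Z -> exists (K : C) (k : hom K A), is_kernel Z f k.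
Proof.
intros hC.
destruct (trivial_part_exists B (sp_mono_coreflective hC)) as (W & eps & Heps).
destruct (sp_pullbacks hC f (trivial_part_normal_mono Heps)) as (K & k & e & Hpb).
exists K, k; exact (pullback_trivial_part_kernel Heps Hpb).
Qed.

(** The restriction of a normal epimorphism to its kernel is again a normal
    epimorphism, onto the trivial part of the codomain, by pullback stability along
    the normal monomorphism [eps]. *)
Lemma normal_epi_kernel (C : category) (Z : subcat C) (K A B : C)
  (f : hom A B) (k : hom K A) :
  semi_prenormal Z -> normal_epi Z f -> is_kernel Z f k ->
  exists (W : C) (eps : hom W B) (e : hom K W),
    Z W /\ is_pullback k e f eps /\ normal_epi Z e.
Proof.
intros hC Hf Hk.
destruct (trivial_part_exists B (sp_mono_coreflective hC)) as (W & eps & Heps).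
destruct (kernel_pullback_trivial_part Heps Hk) as (e & Hpb).
exists W, eps, e; split; [exact (proj1 Heps) | split; [assumption |]].
exact (sp_stable hC Hpb Hf (trivial_part_normal_mono Heps)).
Qed.

(** * Normal-epi-reflective subcategories *)

Lemma reflection_factor (C : category) (F : subcat C)
  (refl : functor C (full_subcategory F)) (adj : adjunction refl (inclusion F))
  (X Y : C) (y : hom X Y) :
  F Y -> exists y' : hom (proj1_sig (refl X)) Y, y = y' ∘ unit_of adj X.
Proof.
intros HY.
(* The transpose of [y] under the adjunction is the counit at [Y] after [Fy]. *)
pose (Y' := exist _ Y HY : full_subcategory F).
pose proof (naturality (unit_of adj) y) as Hnat.
pose proof (triangle_right adj Y') as Htri.
simpl in Hnat, Htri.
exists ((counit_of adj Y' : hom (proj1_sig (refl Y)) Y) ∘ fmap refl y).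
rewrite <- comp_assoc.
transitivity ((counit_of adj Y' : hom (proj1_sig (refl Y)) Y)
              ∘ (unit_of adj Y ∘ y)).
- rewrite comp_assoc.
  transitivity (idm Y ∘ y); [now rewrite comp_idl | f_equal; now symmetry].
- f_equal; exact Hnat.
Qed.

(** For [W] in [Z] every morphism out of [W] is trivial; so the identity of [W]
    factors through the cokernel [φ_W], which is thus a split monomorphism and an
    epimorphism. *)
Lemma trivial_objects_reflected (C : category) (Z F : subcat C)
  (refl : functor C (full_subcategory F)) (adj : adjunction refl (inclusion F))
  (hunit : forall X : C, normal_epi Z (unit_of adj X)) (W : C) :
  Z W -> F W.
Proof.
intros HW.
destruct (normal_epi_factor_trivial (hunit W) (trivial_mor_target (idm W) HW))
  as (r & Hr).
apply (@replete C F (proj1_sig (refl W)) W r); [| exact (proj2_sig (refl W))].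
exists (unit_of adj W); split; [| now symmetry].
apply (normal_epi_cancel (hunit W)).
etransitivity; [symmetry; apply comp_assoc |].
etransitivity; [exact (f_equal (comp (unit_of adj W)) (eq_sym Hr)) |].
rewrite comp_idl; apply comp_idr.
Qed.

(** The torsion class attached to [F]. *)
Definition unit_trivial (C : category) (Z F : subcat C)
  (refl : functor C (full_subcategory F)) (adj : adjunction refl (inclusion F)) :
  subcat C.
Proof.
refine {| mem := fun A => trivial_mor Z (unit_of adj A) |}.
intros A B f (g & _ & Hfg) HA.
pose proof (naturality (unit_of adj) f) as Hnat; simpl in Hnat.
apply (trivial_mor_split_epi Hfg).
refine (eq_ind_r (fun h => trivial_mor Z h) _ Hnat).
now apply trivial_mor_postcomp.
Defined.

(** If [f : A -> X] is the kernel of [g : X -> B], with [A] torsion and [B] in [F],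
    then [f] and [k] factor through each other: [φ_X ∘ f] goes from a torsion object
    to an object of [F], and [g] factors through [φ_X].  So [φ_K] factors through
    [A]. *)
Lemma torsion_theory_kernel_unit_trivial (C : category) (Z F T : subcat C)
  (refl : functor C (full_subcategory F)) (adj : adjunction refl (inclusion F))
  (X K : C) (k : hom K X) :
  torsion_theory Z T F -> is_kernel Z (unit_of adj X) k ->
  trivial_mor Z (unit_of adj K).
Proof.
intros [Htriv Hexact] Hk.
destruct (Hexact X) as (A & B & f & g & HA & HB & [_ Hf] & _).
destruct (proj2 Hk A f) as (f' & Hf' & _).
{ apply Htriv; [assumption | exact (proj2_sig (refl X))]. }
destruct (reflection_factor adj g HB) as (g' & Hg').
destruct (Hf K k) as (k' & Hk' & _).
{ rewrite Hg', <- comp_assoc; apply trivial_mor_postcomp; exact (proj1 Hk). }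
assert (Hid : f' ∘ k' = idm K).
{ exact (mono_mutual_factor (kernel_mono Hk) Hf' Hk'). }
apply (trivial_mor_split_epi Hid).
apply Htriv; [assumption | exact (proj2_sig (refl K))].
Qed.

Lemma torsion_free_iff_kernel_unit_trivial (C : category) (Z F : subcat C)
  (hC : semi_prenormal Z)
  (refl : functor C (full_subcategory F)) (adj : adjunction refl (inclusion F))
  (hunit : forall X : C, normal_epi Z (unit_of adj X)) :
  torsion_free Z F <->
  (forall (X K : C) (k : hom K X), is_kernel Z (unit_of adj X) k ->
     trivial_mor Z (unit_of adj K)).
Proof.
split.
- intros (T & HT) X K k; now apply torsion_theory_kernel_unit_trivial with T.
- intros H; exists (unit_trivial Z adj); split.
  + intros A B f HA HB.
    destruct (reflection_factor adj f HB) as (f' & ->).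
    now apply trivial_mor_postcomp.
  + intros X.
    destruct (kernel_exists (unit_of adj X) hC) as (K & k & Hk).
    exists K, (proj1_sig (refl X)), k, (unit_of adj X).
    split; [exact (H X K k Hk) | split; [exact (proj2_sig (refl X)) |]].
    split; [assumption |].
    exact (normal_epi_cokernel_of_kernel (hunit X) Hk).
Qed.

(** * The naturality square *)

(** Since [φ_K] is trivial, it factors through the cokernel [e]; since the codomain
    of [e] lies in [F], conversely [e] factors through [φ_K]. *)
Lemma kernel_unit_trivial_pullback (C : category) (Z F : subcat C)
  (hC : semi_prenormal Z)
  (refl : functor C (full_subcategory F)) (adj : adjunction refl (inclusion F))
  (hunit : forall X : C, normal_epi Z (unit_of adj X))
  (X K : C) (k : hom K X) :
  is_kernel Z (unit_of adj X) k -> trivial_mor Z (unit_of adj K) ->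
  is_pullback k (unit_of adj K)
    (unit_of adj X) (fmap (inclusion F) (fmap refl k)).
Proof.
intros Hk HK.
destruct (normal_epi_kernel hC (hunit X) Hk) as (W & eps & e & HW & Hpb & He).
destruct (normal_epi_factor_trivial He HK) as (s & Hs).
destruct (reflection_factor adj e (trivial_objects_reflected hunit HW)) as (t & Ht).
assert (Heps : fmap (inclusion F) (fmap refl k) = eps ∘ t).
{ apply (normal_epi_cancel (hunit K)).
  etransitivity; [symmetry; exact (naturality (unit_of adj) k) |].
  etransitivity; [exact (proj1 Hpb) |].
  etransitivity; [exact (f_equal (comp eps) Ht) | apply comp_assoc]. }
rewrite Heps.
apply pullback_replace_leg with e; [| now symmetry | assumption].
exists s; split.
- apply (normal_epi_cancel (hunit K)).
  etransitivity; [symmetry; apply comp_assoc |].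
  etransitivity; [exact (f_equal (comp s) (eq_sym Ht)) |].
  rewrite comp_idl; now symmetry.
- apply (normal_epi_cancel He).
  etransitivity; [symmetry; apply comp_assoc |].
  etransitivity; [exact (f_equal (comp t) (eq_sym Hs)) |].
  rewrite comp_idl; now symmetry.
Qed.

Lemma coequalized_postcomp (C : category) (R K W X B : C) (u v : hom R K)
  (e : hom K W) (eps : hom W B) (k : hom K X) (f : hom X B) :
  f ∘ k = eps ∘ e -> e ∘ u = e ∘ v -> f ∘ (k ∘ u) = f ∘ (k ∘ v).
Proof.
intros Hke Huv.
now rewrite !comp_assoc, Hke, <- !comp_assoc, Huv.
Qed.

Lemma pullback_kernel_unit_trivial (C : category) (Z F : subcat C)
  (hC : semi_prenormal Z)
  (hreg : forall (A B : C) (q : hom A B), normal_epi Z q -> regular_epi q)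
  (refl : functor C (full_subcategory F)) (adj : adjunction refl (inclusion F))
  (hunit : forall X : C, normal_epi Z (unit_of adj X))
  (X K : C) (k : hom K X) :
  is_kernel Z (unit_of adj X) k ->
  is_pullback k (unit_of adj K)
    (unit_of adj X) (fmap (inclusion F) (fmap refl k)) ->
  trivial_mor Z (unit_of adj K).
Proof.
intros Hk [Hsq Hnat].
destruct (normal_epi_kernel hC (hunit X) Hk) as (W & eps & e & HW & [Hke _] & He).
destruct (hreg _ _ _ He) as (R & u & v & Huv & Hcoeq).
destruct (Hcoeq _ (unit_of adj K)) as (s & Hs & _).
- (* The pair [k ∘ u], [φ_K ∘ v] is compatible; the induced morphism into the
     pullback is [u], because [k] is monic. *)
  destruct (Hnat R (k ∘ u) (unit_of adj K ∘ v)) as (w & [Hw1 Hw2] & _).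
  { etransitivity; [exact (coequalized_postcomp Hke Huv) |].
    etransitivity; [apply comp_assoc |].
    etransitivity; [exact (f_equal (fun h => h ∘ v) Hsq) |].
    symmetry; apply comp_assoc. }
  now rewrite <- (kernel_mono Hk Hw1).
- rewrite Hs; apply trivial_mor_postcomp; now apply trivial_mor_target.
Qed.

Theorem proposition3p2 (C : category) (Z : subcat C)
  (hC : prenormal Z)
  (hreg : forall (A B : C) (q : hom A B), normal_epi Z q -> regular_epi q)
  (F : subcat C)
  (refl : functor C (full_subcategory F))
  (adj : adjunction refl (inclusion F))
  (hunit : forall X : C, normal_epi Z (unit_of adj X)) :
  torsion_free Z F <->
  (forall (X K : C) (k : hom K X), is_kernel Z (unit_of adj X) k ->
     is_pullback k (unit_of adj K)
       (unit_of adj X) (fmap (inclusion F) (fmap refl k))).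
Proof.
pose proof (pn_semi_prenormal hC) as hS.
rewrite (torsion_free_iff_kernel_unit_trivial hS hunit).
split; intros H X K k Hk.
- exact (kernel_unit_trivial_pullback hS hunit Hk (H X K k Hk)).
- exact (pullback_kernel_unit_trivial hS hreg hunit Hk (H X K k Hk)).
Qed.
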